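(* Let $K\in\mathcal{S}_0$ and let $B_K$ be the origin-symmetric Euclidean ball in $\mathbb{R}^n$ with $|B_K|=|K|$. For $\phi:(0,\infty)\to(0,\infty)$ write $F(t)=\phi(t^{-1/n})$, $t>0$. (i) For $\phi\in\Phi$, $\widetilde{S}_{\phi}(K)\ge\widetilde{S}_{\phi}(B_K)$. If in addition $F$ is strictly convex, equality holds if and only if $K$ is an origin-symmetric Euclidean ball. (ii) For $\phi\in\Psi$, $\widetilde{S}_{\phi}(K)\le\widetilde{S}_{\phi}(B_K)$. If in addition $F$ is strictly concave, equality holds if and only if $K$ is an origin-symmetric Euclidean ball.
   Context: Fix a positive integer $n$. A star body (about the origin) is a set $K\subset\mathbb{R}^n$ that contains the segment from the origin to each of its points and whose radial function $\rho_K(u)=\max\{\lambda:\lambda u\in K\}$, $u\in S^{n-1}$, is continuous and positive on $S^{n-1}$. $\mathcal{S}_0$ is the set of all star bodies. $|K|$ denotes volume, $\sigma$ is the spherical measure on the unit sphere $S^{n-1}$, and $B^n_2$ is the closed unit Euclidean ball in $\mathbb{R}^n$. An origin-symmetric Euclidean ball is a set $rB^n_2$ with $r>0$. $\Phi$ is the set of functions $\phi:(0,\infty)\to(0,\infty)$ such that $F(t)=\phi(t^{-1/n})$ is either a constant or a convex function on $(0,\infty)$. $\Psi$ is the set of functions $\phi:(0,\infty)\to(0,\infty)$ such that $F(t)=\phi(t^{-1/n})$ is either a constant or an increasing concave function on $(0,\infty)$. (Such $\phi$ are automatically continuous.) For a continuous function $\phi:(0,\infty)\to(0,\infty)$ and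 $K,L\in\mathcal{S}_0$, the Orlicz $L_\phi$-dual mixed volume is $\widetilde{V}_{\phi}(K,L)=\frac1n\int_{S^{n-1}}\phi\big(\frac{\rho_K(u)}{\rho_L(u)}\big)[\rho_K(u)]^n\,d\sigma(u)$, and the Orlicz $L_\phi$-dual surface area of $K$ is $\widetilde{S}_{\phi}(K)=n\widetilde{V}_{\phi}(K,B^n_2)$. *)

(* Defs.v *)
From HB Require Import structures.
From mathcomp Require Import all_boot all_order all_algebra.
From mathcomp Require Import all_classical all_reals all_analysis.
From mathcomp Require Import measurable_realfun.

Set Implicit Arguments.
Unset Strict Implicit.
Unset Printing Implicit Defensive.

Import Order.TTheory GRing.Theory Num.Theory.
Import numFieldNormedType.Exports.

Local Open Scope classical_set_scope.
Local Open Scope ring_scope.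

(* R^n is 'rV[R]_n; its sigma-algebra is the product one, generated by the
   coordinate functions, as the library does for tuples. *)
Section measurable_rV.
Context {R : realType}.
Variable n : nat.

Let coors : 'I_n -> 'rV[R]_n -> measurableTypeR R := fun i x => x ord0 i.

Let rV_set0 : g_sigma_preimage coors set0.
Proof. exact: sigma_algebra0. Qed.

Let rV_setC A : g_sigma_preimage coors A -> g_sigma_preimage coors (~` A).
Proof. exact: sigma_algebraC. Qed.

Let rV_bigcup (F : (set 'rV[R]_n)^nat) :
  (forall i, g_sigma_preimage coors (F i)) ->
  g_sigma_preimage coors (\bigcup_i (F i)).
Proof. exact: sigma_algebra_bigcup. Qed.

HB.instance Definition _ := @isMeasurable.Build default_measure_display
  'rV[R]_n (g_sigma_preimage coors) rV_set0 rV_setC rV_bigcup.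

Lemma measurable_coor (i : 'I_n) :
  measurable_fun [set: 'rV[R]_n] (fun x => x ord0 i : measurableTypeR R).
Proof.
move=> _ Y mY; rewrite setTI; apply: sub_sigma_algebra => /=.
rewrite -bigcup_seq/=; exists i => /=; first by rewrite mem_index_enum.
by exists Y => //; rewrite setTI.
Qed.

Lemma measurable_fun_rVP d (T : measurableType d) (f : T -> 'rV[R]_n) :
  measurable_fun [set: T] f <->
  forall i, measurable_fun [set: T] (fun t => f t ord0 i : measurableTypeR R).
Proof.
split=> [mf i|mf].
  exact: (measurableT_comp (measurable_coor i) mf).
have sub : g_sigma_preimage (fun i => coors i \o f) `<=` measurable.
  apply: smallest_sub; first exact: sigma_algebra_measurable.
  elim/big_ind : _ => //.
    by move=> A B sA sB C [/sA|/sB].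
  by move=> i _ A [B mB <-]; exact: mf.
by move: sub; rewrite g_sigma_preimage_comp => sub _ A mA; apply: sub; exists A.
Qed.

End measurable_rV.

Section lebesgue_rV.
Context {R : realType}.

Definition cons_rV n (p : measurableTypeR R * 'rV[R]_n) : 'rV[R]_n.+1 :=
  \row_i if unlift ord0 i is Some j then p.2 ord0 j else p.1.

Lemma measurable_cons_rV n : measurable_fun setT (@cons_rV n).
Proof.
apply/measurable_fun_rVP => i.
under eq_fun do rewrite mxE.
case: (unlift ord0 i) => [j|]; last exact: measurable_fst.
exact: (measurableT_comp (measurable_coor j) measurable_snd).
Qed.

Definition uncons_rV n (x : 'rV[R]_n.+1) : measurableTypeR R * 'rV[R]_n :=
  (x ord0 ord0, \row_j x ord0 (lift ord0 j)).

Lemma uncons_rVK n : cancel (@uncons_rV n) (@cons_rV n).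
Proof.
move=> x; apply/rowP => i.
by rewrite mxE; case: unliftP => [j|] ->; rewrite ?mxE.
Qed.

Lemma cons_rVK n : cancel (@cons_rV n) (@uncons_rV n).
Proof.
move=> [a x]; rewrite /uncons_rV mxE unlift_none; congr pair.
by apply/rowP => j; rewrite !mxE liftK.
Qed.

Lemma measurable_uncons_rV n : measurable_fun setT (@uncons_rV n).
Proof.
apply: measurable_fun_pair; first exact: measurable_coor.
apply/measurable_fun_rVP => i; under eq_fun do rewrite mxE.
exact: measurable_coor.
Qed.

(* n-dimensional Lebesgue measure as the n-fold product of the Lebesgue measure
   of R; R^0 is a point of mass 1. *)
Fixpoint lebesgue_rV n : set 'rV[R]_n -> \bar R :=
  match n with
  | 0%N => \d_(0 : 'rV[R]_0)
  | m.+1 => pushforward (lebesgue_measure \x @lebesgue_rV m)%E (@cons_rV m)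
  end.


Section step.
Variables (n : nat) (m : {sigma_finite_measure set 'rV[R]_n -> \bar R}).

Let step := pushforward (lebesgue_measure \x m)%E (@cons_rV n).

Let step0 : step set0 = 0%E.
Proof. by rewrite /step /pushforward preimage_set0 measure0. Qed.

Let step_ge0 A : (0 <= step A)%E.
Proof. by rewrite /step /pushforward. Qed.

Let step_sigma_additive : semi_sigma_additive step.
Proof.
move=> F mF tF mUF; rewrite /step /pushforward preimage_bigcup.
have mpre A : measurable A -> measurable (@cons_rV n @^-1` A).
  by move=> mA; rewrite -[X in measurable X]setTI; exact: measurable_cons_rV.
apply: measure_semi_sigma_additive.
- by move=> k; exact: mpre.
- apply/trivIsetP => /= i j _ _ ij; rewrite -preimage_setI.
  by move/trivIsetP : tF => /(_ _ _ _ _ ij) ->//; rewrite preimage_set0.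
- by rewrite -preimage_bigcup; exact: mpre.
Qed.

HB.instance Definition _ := isMeasure.Build _ _ _ step
  step0 step_ge0 step_sigma_additive.

Let step_sigma_finite : sigma_finite setT step.
Proof.
have /sigma_finiteP[F [TF ndF Foo]] := sigma_finiteT (@lebesgue_measure R).
have /sigma_finiteP[G [TG ndG Goo]] := sigma_finiteT m.
exists (fun k => @uncons_rV n @^-1` (F k `*` G k)).
  rewrite -preimage_bigcup (_ : \bigcup_k _ = setT) ?preimage_setT//.
  apply/seteqP; split => // -[x y] _.
  have [i _ Fix] : (\bigcup_k F k) x by rewrite -TF.
  have [j _ Gjy] : (\bigcup_k G k) y by rewrite -TG.
  exists (maxn i j) => //; split => /=.
    by move: x Fix; exact/subsetPset/ndF/leq_maxl.
  by move: y Gjy; exact/subsetPset/ndG/leq_maxr.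
move=> k; have [mFk Fk] := Foo k; have [mGk Gk] := Goo k.
have mF : measurable (F k `*` G k) by exact: measurableX.
have oo : ((@lebesgue_measure R \x m)%E (F k `*` G k) < +oo)%E.
  by rewrite product_measure1E// lte_mul_pinfty// ge0_fin_numE.
split.
  by rewrite -[X in measurable X]setTI; exact: measurable_uncons_rV.
rewrite /step /pushforward -comp_preimage.
rewrite (_ : _ \o _ = id) ?preimage_id//.
by apply/funext => p /=; exact: cons_rVK.
Qed.

HB.instance Definition _ := Measure_isSigmaFinite.Build _ _ _ step
  step_sigma_finite.

Definition lebesgue_rV_step :
  {sigma_finite_measure set 'rV[R]_n.+1 -> \bar R} := step.

End step.

Let lebesgue_rV_exists n :
  exists m : {sigma_finite_measure set 'rV[R]_n -> \bar R},
    m = @lebesgue_rV n :> (set 'rV[R]_n -> \bar R).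
Proof.
elim: n => [|n [m /= <-]]; first by exists (\d_(0 : 'rV[R]_0)).
by exists (lebesgue_rV_step m).
Qed.

Section instances.
Variable n : nat.

Let lebesgue_rV0 : @lebesgue_rV n set0 = 0%E.
Proof. by have [m <-] := lebesgue_rV_exists n; exact: measure0. Qed.

Let lebesgue_rV_ge0 A : (0 <= @lebesgue_rV n A)%E.
Proof. by have [m <-] := lebesgue_rV_exists n; exact: measure_ge0. Qed.

Let lebesgue_rV_sigma_additive : semi_sigma_additive (@lebesgue_rV n).
Proof.
have [m <-] := lebesgue_rV_exists n.
exact: measure_semi_sigma_additive.
Qed.

HB.instance Definition _ := isMeasure.Build _ _ _ (@lebesgue_rV n)
  lebesgue_rV0 lebesgue_rV_ge0 lebesgue_rV_sigma_additive.

Let lebesgue_rV_sigma_finite : sigma_finite setT (@lebesgue_rV n).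
Proof. by have [m <-] := lebesgue_rV_exists n; exact: sigma_finiteT. Qed.

HB.instance Definition _ := Measure_isSigmaFinite.Build _ _ _ (@lebesgue_rV n)
  lebesgue_rV_sigma_finite.

End instances.

End lebesgue_rV.

Section euclidean.
Context {R : realType} {n : nat}.
Implicit Types (x u : 'rV[R]_n) (A K L : set 'rV[R]_n).

Definition enorm x : R := Num.sqrt (\sum_(i < n) x ord0 i ^+ 2).

Definition eball (r : R) : set 'rV[R]_n := [set x | enorm x <= r].

Definition esphere : set 'rV[R]_n := [set u | enorm u = 1].

Definition origin_ball A := exists2 r : R, 0 < r & A = eball r.

(* Spherical measure through polar coordinates: for a Borel set A of directions,
   sigma(A) = n |{t u : 0 < t <= 1, u \in A}|.  It is extended to the Borel sets
   of R^n by ignoring the points off the unit sphere. *)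
Definition cone A : set 'rV[R]_n :=
  [set x | exists t u, [/\ 0 < t <= 1, esphere u, A u & x = t *: u]].

Definition spherical_measure A : \bar R :=
  (n%:R%:E * lebesgue_rV (cone A))%E.

Lemma measurable_enorm : measurable_fun [set: 'rV[R]_n] enorm.
Proof.
rewrite /enorm; apply: measurableT_comp.
  by apply: continuous_measurable_fun; exact: sqrt_continuous.
by apply: measurable_sum => i; apply: measurable_funX; exact: measurable_coor.
Qed.

Lemma enormZ (t : R) x : enorm (t *: x) = `|t| * enorm x.
Proof.
rewrite /enorm; under eq_bigr do rewrite mxE exprMn.
by rewrite -mulr_sumr sqrtrM ?sqr_ge0// sqrtr_sqr.
Qed.

Lemma coneE A :
  cone A = (eball 1 `\` [set x | enorm x = 0]) `&`
           ((fun x => (enorm x)^-1 *: x) @^-1` A).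
Proof.
apply/seteqP; split=> [_ [t [u [/andP[t0 t1] Su Au ->]]]|x [[x1 x0] Ax]] /=.
  have E : enorm (t *: u) = t by rewrite enormZ Su mulr1 gtr0_norm.
  rewrite /eball /= E scalerA mulVf ?scale1r ?gt_eqF//; split => //; split => //.
  by apply/eqP; rewrite gt_eqF.
have x0' : 0 < enorm x by rewrite lt_neqAle eq_sym sqrtr_ge0 andbT; apply/eqP.
exists (enorm x), ((enorm x)^-1 *: x); split => //.
- by rewrite x0'.
- by rewrite /esphere /= enormZ ger0_norm ?invr_ge0 ?ltW// mulVf ?gt_eqF.
- by rewrite scalerA mulfV ?scale1r ?gt_eqF.
Qed.

Lemma measurable_eball r : measurable (eball r).
Proof.
rewrite (_ : eball r = setT `&` enorm @^-1` `]-oo, r]).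
  by apply: measurable_enorm => //; exact: measurable_itv.
by rewrite setTI; apply/seteqP; split => x /=; rewrite in_itv.
Qed.

Lemma measurable_esphere : measurable esphere.
Proof.
rewrite (_ : esphere = setT `&` enorm @^-1` [set 1]) ?setTI//.
by rewrite -[X in measurable X]setTI; exact: measurable_enorm.
Qed.

Lemma measurable_cone A : measurable A -> measurable (cone A).
Proof.
move=> mA; rewrite coneE; apply: measurableI.
  apply: measurableD; first exact: measurable_eball.
  rewrite (_ : [set x | _] = setT `&` enorm @^-1` [set 0]) ?setTI//.
  by rewrite -[X in measurable X]setTI; exact: measurable_enorm.
rewrite -[X in measurable X]setTI.
suff : measurable_fun setT (fun x => (enorm x)^-1 *: x) by exact.
apply/measurable_fun_rVP => i; under eq_fun do rewrite mxE.
apply: measurable_funM; last exact: measurable_coor.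
under eq_fun do rewrite -powR_inv1 ?sqrtr_ge0//.
exact: (measurableT_comp (measurable_powR _) measurable_enorm).
Qed.

Let spherical_measure0 : spherical_measure set0 = 0%E.
Proof. by rewrite /spherical_measure coneE preimage_set0 setI0 measure0 mule0. Qed.

Let spherical_measure_ge0 A : (0 <= spherical_measure A)%E.
Proof. by apply: mule_ge0; rewrite ?lee_fin. Qed.

Let spherical_measure_sigma_additive : semi_sigma_additive spherical_measure.
Proof.
move=> F mF tF mUF; rewrite /spherical_measure.
have -> : cone (\bigcup_k F k) = \bigcup_k cone (F k).
  rewrite coneE preimage_bigcup setI_bigcupr.
  by apply: eq_bigcup => // k _; rewrite coneE.
under eq_fun do rewrite -ge0_sume_distrr//.
apply: cvgeZl => //.
apply: measure_semi_sigma_additive.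
- by move=> k; exact: measurable_cone.
- apply/trivIsetP => /= i j _ _ ij; rewrite !coneE setIACA setIid -preimage_setI.
  by move/trivIsetP : tF => /(_ _ _ _ _ ij) ->//; rewrite preimage_set0 setI0.
- by apply: bigcupT_measurable => k; exact: measurable_cone.
Qed.

HB.instance Definition _ := isMeasure.Build _ _ _ spherical_measure
  spherical_measure0 spherical_measure_ge0 spherical_measure_sigma_additive.

End euclidean.

Section star_bodies.
Context {R : realType} {n : nat}.
Implicit Types (u : 'rV[R]_n) (K L : set 'rV[R]_n) (phi : R -> R).

Definition radial_set K u : set R := [set l : R | K (l *: u)].

(* [sup] is total; [star_body] requires it to be the maximum of [radial_set]. *)
Definition radial K u : R := sup (radial_set K u).

Definition star_body K :=
  [/\ forall x t, K x -> 0 <= t <= 1 -> K (t *: x),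
      forall u, esphere u ->
        radial_set K u (radial K u) /\ ubound (radial_set K u) (radial K u),
      forall u, esphere u -> 0 < radial K u
    & {within esphere, continuous (radial K)}].

Definition dual_mixed_volume phi K L : \bar R :=
  ((n%:R^-1)%:E * \int[spherical_measure]_(u in esphere)
     (phi (radial K u / radial L u) * radial K u ^+ n)%:E)%E.

Definition dual_surface_area phi K : \bar R :=
  (n%:R%:E * dual_mixed_volume phi K (eball 1))%E.

End star_bodies.

Section function_classes.
Local Open Scope convex_scope.
Context {R : realType}.
Implicit Types (phi F : R -> R).

Definition posreals : set R := `]0, +oo[%classic.

Definition strictly_convex_function (E : lmodType R)
    (E' := convex_lmodType E) (D : set E') (f : E' -> R^o) :=
  forall t : {i01 R}, 0 < t%:num < 1 ->
    {in D &, forall x y : E', x != y -> (f (x <| t |> y) < f x <| t |> f y)%R}.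

Definition convex_pos F := convex_function (E := R^o) posreals F.
Definition strictly_convex_pos F :=
  strictly_convex_function (E := R^o) posreals F.
Definition concave_pos F := convex_pos (\- F).
Definition strictly_concave_pos F := strictly_convex_pos (\- F).
Definition increasing_pos F := {in posreals &, {homo F : s t / s <= t}}.
Definition constant_pos F := exists c, {in posreals, forall t, F t = c}.

Definition orlicz_F (n : nat) phi : R -> R := fun t => phi (t `^ (- n%:R^-1)).

(* phi : (0,oo) -> (0,oo) is a total function R -> R whose values outside (0,oo)
   play no role. *)
Definition positive_pos phi := {in posreals, forall t, 0 < phi t}.

Definition Phi (n : nat) : set (R -> R) :=
  [set phi | positive_pos phi /\
    (constant_pos (orlicz_F n phi) \/ convex_pos (orlicz_F n phi))].

Definition Psi (n : nat) : set (R -> R) :=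
  [set phi | positive_pos phi /\
    (constant_pos (orlicz_F n phi) \/
     increasing_pos (orlicz_F n phi) /\ concave_pos (orlicz_F n phi))].

End function_classes.

(* Main.v *)
Require Import Defs.
From mathcomp Require Import all_boot all_order all_algebra.
From mathcomp Require Import all_classical all_reals all_analysis.
From mathcomp Require Import measurable_realfun lra ring.
Import Order.TTheory GRing.Theory Num.Theory.
Import numFieldNormedType.Exports.
Local Open Scope classical_set_scope.
Local Open Scope ring_scope.

(** The spherical measure and the volume are related by polar coordinates:
    [n |K|] is the integral of [rho_K ^ n] over the sphere.  This is checked by
    sandwiching the part of [K] above a set of directions where
    [a <= rho_K <= c a] between two dilates of the cone over that set, and
    letting [c] tend to [1].  With [w = rho_K ^ n] and [s = r ^ - n], where [r]
    is the radius of [B_K], the dual surface area of [K] is the integral of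
    [F (1 / w) * w], and a supporting line [F t >= F s + a (t - s)] gives
    [F (1 / w) * w >= (F s - a s) w + a], whose right-hand side integrates to the
    dual surface area of [B_K] because the volumes agree.  If [F] is strictly
    convex, equality forces [rho_K = r] almost everywhere, hence everywhere since
    nonempty relatively open subsets of the sphere have positive measure.  The
    concave case is the same with the inequalities reversed. *)

(** * Convex functions on the positive half-line *)

Section convexity.
Context {R : realType}.
Implicit Types (F : R -> R) (x y t s : R).

Lemma in_posreals x : (x \in posreals) = (0 < x).
Proof. by rewrite /posreals mem_setE in_itv/= andbT. Qed.

Lemma convex_posP F x y t : convex_pos F -> 0 < x -> 0 < y -> 0 <= t <= 1 ->
  F (t * x + (1 - t) * y) <= t * F x + (1 - t) * F y.
Proof.
move=> cF x0 y0 /andP[t0 t1].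
by have := cF (Itv01 t0 t1) x y; rewrite !in_posreals; exact.
Qed.

Lemma strictly_convex_posP F x y t : strictly_convex_pos F ->
  0 < x -> 0 < y -> x != y -> 0 < t < 1 ->
  F (t * x + (1 - t) * y) < t * F x + (1 - t) * F y.
Proof.
move=> cF x0 y0 xy /andP[t0 t1].
have := cF (Itv01 (ltW t0) (ltW t1)) _ x y; rewrite /= !in_posreals t0 t1.
exact.
Qed.

(** Convexity is applied at [s], the convex combination of [x] and [y] with weight
    [(y - s) / (y - x)] on [x]. *)
Lemma convex_pos_slope F x s y : convex_pos F -> 0 < x -> x < s -> s < y ->
  (F s - F x) / (s - x) <= (F y - F s) / (y - s).
Proof.
move=> cF x0 xs sy; have yx : 0 < y - x by lra.
rewrite ler_pdivrMr ?subr_gt0// mulrAC ler_pdivlMr ?subr_gt0//.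
have h : (y - s) / (y - x) * x + (1 - (y - s) / (y - x)) * y = s.
  by field; rewrite gt_eqF.
have := @convex_posP F x y ((y - s) / (y - x)) cF x0.
rewrite h divr_ge0 ?ler_pdivrMr//; try lra.
move=> /(_ _ _)/[!mul1r].
have -> : (y - s) / (y - x) * F x + (1 - (y - s) / (y - x)) * F y =
  ((y - s) * F x + (s - x) * F y) / (y - x) by field; rewrite gt_eqF.
rewrite ler_pdivlMr// => /(_ ltac:(lra) ltac:(lra)); lra.
Qed.

(** The slope [a] is the supremum of the slopes of chords reaching [s] from the left; each chord
    leaving [s] to the right bounds these slopes from above, so the line stays below [F] on both
    sides. *)
Lemma convex_pos_support F s : convex_pos F -> 0 < s ->
  exists a, forall t, 0 < t -> F s + a * (t - s) <= F t.
Proof.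
move=> cF s0.
pose A := [set (F s - F x) / (s - x) | x in [set x | 0 < x < s]].
have Aub y : s < y -> ubound A ((F y - F s) / (y - s)).
  by move=> sy _ [x /andP[x0 xs] <-]; exact: convex_pos_slope.
have A0 : A !=set0.
  by exists ((F s - F (s / 2)) / (s - s / 2)), (s / 2) => //=; lra.
exists (sup A) => t t0; have [ts|st|->] := ltgtP t s; last by lra.
- have : (F s - F t) / (s - t) <= sup A.
    apply: ub_le_sup; first by exists ((F (s + 1) - F s) / (s + 1 - s));
      apply: Aub; lra.
    by exists t => //=; rewrite t0.
  rewrite ler_pdivrMr ?subr_gt0//; lra.
- have : sup A <= (F t - F s) / (t - s) by apply: ge_sup => //; exact: Aub.
  rewrite ler_pdivlMr ?subr_gt0//; lra.
Qed.

(** At the midpoint of [s] and [t] the line is below [F] and [F] is strictly below its chord; line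
    and chord agree at [s], so they differ strictly at [t]. *)
Lemma strictly_convex_pos_support F s a : strictly_convex_pos F -> 0 < s ->
  (forall t, 0 < t -> F s + a * (t - s) <= F t) ->
  forall t, 0 < t -> t != s -> F s + a * (t - s) < F t.
Proof.
move=> cF s0 Fa t t0 ts.
have := Fa (2^-1 * t + (1 - 2^-1) * s) ltac:(lra).
have := @strictly_convex_posP F t s 2^-1 cF t0 s0 ts ltac:(lra).
lra.
Qed.

(** Sublevel sets of a convex function are intervals, and the sets where [F > r] are their
    complements in [posreals]. *)
Lemma measurable_convex_pos F : convex_pos F -> measurable_fun posreals F.
Proof.
move=> cF mD; apply: (measurability _ (RGenOInfty.measurableE R)) => //.
move=> _ [_ [r ->] <-].
have -> : posreals `&` F @^-1` `]r, +oo[ =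
    posreals `\` (posreals `&` [set x | F x <= r]).
  apply/seteqP; split => x; rewrite /posreals/= !in_itv/= !andbT.
    by move=> [x0 rx]; split => // -[_]; rewrite leNgt rx.
  by move=> [x0 /not_andP[]// /negP]; rewrite -ltNge.
apply: measurableD => //; apply: is_interval_measurable.
apply/is_intervalPlt => x y [/= x0 Fx] [y0 Fy] z /andP[xz zy].
move: x0 y0; rewrite /posreals/= !in_itv/= !andbT => x0 y0.
split; first lra.
have yx : 0 < y - x by lra.
have h : (y - z) / (y - x) * x + (1 - (y - z) / (y - x)) * y = z.
  by field; rewrite gt_eqF.
have t0 : 0 <= (y - z) / (y - x) by rewrite divr_ge0; lra.
have t1 : (y - z) / (y - x) <= 1 by rewrite ler_pdivrMr; lra.
have := @convex_posP F x y ((y - z) / (y - x)) cF x0 y0.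
rewrite h t0 t1 => /(_ isT) /le_trans; apply.
move: ((y - z) / (y - x)) t0 t1 => t t0 t1; nra.
Qed.

Lemma measurable_inv : measurable_fun setT (fun x : R => x^-1).
Proof.
have m0 : measurable [set (0 : R)] by [].
have -> : [set: R] = [set 0] `|` ~` [set 0] by rewrite setUv.
apply/measurable_funU => //; first exact: measurableC.
split; first exact: measurable_fun_set1.
apply: open_continuous_measurable_fun.
  exact/closed_openC/accessible_closed_set1/hausdorff_accessible/Rhausdorff.
by move=> x; rewrite inE/= => /eqP x0; exact: inv_continuous.
Qed.

End convexity.

(** * Jensen's inequality for [F (1 / w) * w], with its equality case *)

Section jensen.
Context d (T : measurableType d) (R : realType).
Variables (mu : {measure set T -> \bar R}) (D : set T).
Hypothesis mD : measurable D.

(** The nonnegative function [g - f] has integral zero, so it vanishes almost everywhere. *)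
Lemma integral_eq_null (f g : T -> R) :
  mu.-integrable D (EFin \o f) -> mu.-integrable D (EFin \o g) ->
  (forall x, D x -> f x <= g x) ->
  (\int[mu]_(x in D) (f x)%:E = \int[mu]_(x in D) (g x)%:E)%E ->
  mu (D `&` [set x | f x != g x]) = 0%E.
Proof.
move=> fi gi fg fgE.
have mf := measurable_int mu fi; have mg := measurable_int mu gi.
have /(ae_eq_integral_abs mu mD) : (\int[mu]_(x in D) `|(g x)%:E - (f x)%:E| = 0)%E.
  under eq_integral.
    move=> x; rewrite inE => Dx.
    rewrite gee0_abs; last by rewrite -EFinB lee_fin subr_ge0 fg.
    over.
  rewrite integralB_EFin// fgE subee//.
  exact: integrable_fin_num.
have mgf : measurable_fun D (fun x => (g x)%:E - (f x)%:E)%E.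
  exact: emeasurable_funB.
have -> : D `&` [set x | f x != g x] =
  D `&` [set x | ((g x)%:E - (f x)%:E)%E != 0%E].
  by apply/seteqP; split=> x /= [Dx]; rewrite -EFinB eqe subr_eq0 eq_sym.
case/(_ mgf) => N [mN N0 DN].
apply/eqP; rewrite -measure_le0 -[leRHS]N0 le_measure ?inE//.
  exact: emeasurable_neq.
move=> x [Dx /= h]; apply: DN => /= /(_ Dx) e.
by move/eqP : h; rewrite e.
Qed.

Variables (w : T -> R) (W s : R).
Hypothesis mw : measurable_fun D w.
Hypothesis w_gt0 : forall x, D x -> 0 < w x.
Hypothesis s_gt0 : 0 < s.
Hypothesis wW : (\int[mu]_(x in D) (w x)%:E = W%:E)%E.
(** Since [1 / w * w = 1], this makes [s] the mean of [1 / w] with weight [w], which is where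
    Jensen's inequality takes its supporting line. *)
Hypothesis muD : (mu D = (s * W)%:E)%E.

Let wi : mu.-integrable D (EFin \o w).
Proof.
apply/integrableP; split; first exact/measurable_EFinP.
under eq_integral => x /[!inE] Dx do rewrite gee0_abs ?lee_fin ?(ltW (w_gt0 _ Dx))//.
by rewrite wW ltry.
Qed.

(** The line [b + a * (t - s)] at [t = 1 / w], multiplied by [w]. Being affine in [w], it has an
    integral determined by [W] and [s]. *)
Let line (b a : R) x := (b - a * s) * w x + a.

Let line_integrable b a : mu.-integrable D (EFin \o line b a).
Proof.
have -> : EFin \o line b a = ((fun x => (b - a * s)%:E * (w x)%:E) \+ cst a%:E)%E.
  by apply/funext => x; rewrite /line /= EFinD EFinM.
apply: integrableD => //; first exact: integrableZl.
apply/integrableP; split; first exact: measurable_cst.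
rewrite (_ : (fun x => _) = cst `|a|%:E)// integral_cst// muD.
by rewrite -EFinM ltry.
Qed.

Let line_integral b a : (\int[mu]_(x in D) (line b a x)%:E = (b * W)%:E)%E.
Proof.
under eq_integral do rewrite /line EFinD EFinM.
rewrite integralD//; last 2 first.
- exact: integrableZl.
- apply/integrableP; split; first exact: measurable_cst.
  rewrite (_ : (fun x => _) = cst `|a|%:E)// integral_cst// muD.
  by rewrite -EFinM ltry.
rewrite integralZl// wW -[X in (_ + X)%E]/(\int[mu]_(x in D) cst a%:E x)%E.
rewrite integral_cst// muD -!EFinM -EFinD; congr (_%:E); ring.
Qed.

Let mpersp (F : R -> R) : measurable_fun posreals F ->
  measurable_fun D (fun x => F (w x)^-1 * w x).
Proof.
move=> mF; apply: measurable_funM => //.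
apply: (@measurable_comp _ _ _ _ _ _ posreals F D (fun x => (w x)^-1)) => //.
- exact: measurable_itv.
- by move=> _ [x Dx <-]; rewrite /posreals/= in_itv/= invr_gt0 w_gt0.
- exact: (measurableT_comp measurable_inv mw).
Qed.

Let lineE (F : R -> R) a x : D x ->
  line (F s) a x = (F s + a * ((w x)^-1 - s)) * w x.
Proof. by move=> /w_gt0 wx; rewrite /line; field; rewrite gt_eqF. Qed.

Lemma jensen_convex F : convex_pos F -> {in posreals, forall t, 0 < F t} ->
  ((F s * W)%:E <= \int[mu]_(x in D) (F (w x)^-1 * w x)%:E)%E /\
  (strictly_convex_pos F ->
   (\int[mu]_(x in D) (F (w x)^-1 * w x)%:E = (F s * W)%:E)%E ->
   mu (D `&` [set x | w x != s^-1]) = 0%E).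
Proof.
move=> cF F0; have [a Fa] := convex_pos_support F s cF s_gt0.
have mF := mpersp F (measurable_convex_pos _ cF).
have F_ge0 x : D x -> (0 <= F (w x)^-1 * w x).
  move=> Dx; rewrite mulr_ge0// ?ltW ?w_gt0//.
  by apply: F0; rewrite in_posreals invr_gt0 w_gt0.
have le x : D x -> line (F s) a x <= F (w x)^-1 * w x.
  by move=> Dx; rewrite lineE// ler_pM2r ?w_gt0// Fa// invr_gt0 w_gt0.
(* If the integral is infinite, the inequality is trivial and equality is impossible. *)
have := @leey _ (\int[mu]_(x in D) (F (w x)^-1 * w x)%:E)%E.
rewrite le_eqVlt => /predU1P[->|Foo]; first by rewrite leey.
have Fi : mu.-integrable D (EFin \o (fun x => F (w x)^-1 * w x)).
  apply/integrableP; split; first exact/measurable_EFinP.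
  by under eq_integral => x /[!inE] Dx do
    rewrite gee0_abs ?lee_fin ?F_ge0//.
split.
  rewrite -(line_integral _ a); apply: le_integral => //.
    exact: line_integrable.
  by move=> x /[!inE] Dx; rewrite lee_fin le.
move=> sF E.
rewrite -(integral_eq_null _ _ (line_integrable (F s) a) Fi le); last first.
  by rewrite E line_integral.
congr (mu _); apply/seteqP; split => x /= [Dx wx]; split => //.
- rewrite lineE// lt_eqF// ltr_pM2r ?w_gt0//.
  apply: strictly_convex_pos_support => //; first by rewrite invr_gt0 w_gt0.
  by apply: contra wx => /eqP <-; rewrite invrK.
- by apply: contra wx => /eqP wx; rewrite lineE// wx invrK subrr mulr0 addr0.
Qed.

Lemma jensen_concave F : concave_pos F -> {in posreals, forall t, 0 < F t} ->
  (\int[mu]_(x in D) (F (w x)^-1 * w x)%:E <= (F s * W)%:E)%E /\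
  (strictly_concave_pos F ->
   (\int[mu]_(x in D) (F (w x)^-1 * w x)%:E = (F s * W)%:E)%E ->
   mu (D `&` [set x | w x != s^-1]) = 0%E).
Proof.
move=> cF F0; have [a Fa] := convex_pos_support (\- F) s cF s_gt0.
have mF : measurable_fun D (fun x => F (w x)^-1 * w x).
  apply: mpersp; rewrite (_ : F = \- (\- F)); last first.
    by apply/funext => x /=; rewrite opprK.
  by apply: measurableT_comp => //; exact: measurable_convex_pos.
have F_ge0 x : D x -> (0 <= F (w x)^-1 * w x).
  move=> Dx; rewrite mulr_ge0// ?ltW ?w_gt0//.
  by apply: F0; rewrite in_posreals invr_gt0 w_gt0.
(* A line of slope [a] supporting [- F] from below is a line of slope [- a] above [F]. *)
have le x : D x -> F (w x)^-1 * w x <= line (F s) (- a) x.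
  move=> Dx; rewrite lineE// ler_pM2r ?w_gt0//.
  by have /= := Fa (w x)^-1; rewrite invr_gt0 w_gt0// => /(_ isT); lra.
(* Positivity of [F] and the integrable upper bound give integrability, so no infinite case arises
   here. *)
have Fi : mu.-integrable D (EFin \o (fun x => F (w x)^-1 * w x)).
  apply: le_integrable (line_integrable (F s) (- a)) => //.
    exact/measurable_EFinP.
  move=> x Dx /=; rewrite lee_fin ger0_norm ?F_ge0//.
  by rewrite (le_trans (le x Dx))// ler_norm.
split.
  rewrite -(line_integral _ (- a)); apply: le_integral => //.
    exact: line_integrable.
  by move=> x /[!inE] Dx; rewrite lee_fin le.
move=> sF E.
rewrite -(integral_eq_null _ _ Fi (line_integrable (F s) (- a)) le); last first.
  by rewrite E line_integral.
congr (mu _); apply/seteqP; split => x /= [Dx wx]; split => //.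
- rewrite lineE// lt_eqF// ltr_pM2r ?w_gt0//.
  have := @strictly_convex_pos_support R (\- F) s a sF s_gt0 Fa (w x)^-1.
  rewrite invr_gt0 w_gt0// => /(_ isT).
  have -> : (w x)^-1 != s by apply: contra wx => /eqP <-; rewrite invrK.
  by move=> /(_ isT)/=; lra.
- by apply: contra wx => /eqP wx; rewrite lineE// wx invrK subrr mulr0 addr0.
Qed.

End jensen.

(* The library's measure structure on [pushforward] is shadowed by the more
   specific instance declared in [Defs], hence the explicit name. *)
Local Notation pushforward_measure :=
  measure_function_pushforward__canonical__measure_function_Measure.

(** * Lebesgue measure on R^n: dilations, cubes and open sets *)

Section lebesgue_scaling.
Context {R : realType}.

(** The right-hand side is a measure in [A] giving each half-open interval its length, which
    characterises Lebesgue measure. *)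
Lemma lebesgue_measure_scale (c : R) (A : set (measurableTypeR R)) : 0 < c ->
  measurable A ->
  lebesgue_measure A = (c%:E * lebesgue_measure (( *%R c) @^-1` A))%E.
Proof.
move=> c0 mA.
have mc : measurable_fun [set: measurableTypeR R]
    ( *%R c : _ -> measurableTypeR R).
  exact: mulrl_measurable.
have c0' := ltW c0.
have -> : (c%:E * lebesgue_measure (( *%R c) @^-1` A))%E =
  pushforward_measure (mscale (NngNum c0') lebesgue_measure) mc A by [].
apply: lebesgue_measure_unique => //= _ [[a b] _ <-].
rewrite /mscale /= /pushforward.
have -> : ( *%R c) @^-1` `]a, b] = `]a / c, b / c]%classic.
  apply/seteqP; split => x /=; rewrite !in_itv/= ltr_pdivrMr// ler_pdivlMr//;
  by rewrite mulrC.
rewrite !lebesgue_measure_itv/= !lte_fin ltr_pM2r ?invr_gt0//.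
case: ifP => _; last by rewrite mule0.
rewrite -!EFinB -EFinM; congr (_%:E); field; by rewrite gt_eqF.
Qed.

Lemma measurable_scale_rV n (c : R) :
  measurable_fun setT (fun x : 'rV[R]_n => c *: x).
Proof.
apply/measurable_fun_rVP => i; under eq_fun do rewrite mxE.
apply: measurable_funM => //; exact: measurable_coor.
Qed.

(** Induction on the dimension: [cons_rV] commutes with dilations, and the rescaled measure agrees
    with the product measure on rectangles, hence everywhere. *)
Lemma lebesgue_rV_scale n (c : R) (A : set 'rV[R]_n) : 0 < c -> measurable A ->
  lebesgue_rV A = ((c ^+ n)%:E * lebesgue_rV (( *:%R c) @^-1` A))%E.
Proof.
move=> c0; elim: n A => [|n IH] A mA.
  rewrite expr0 mul1e; congr (_ _).
  apply/seteqP; split => x /=; suff -> : c *: x = x by [];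
    by apply/rowP; case.
pose S (p : measurableTypeR R * 'rV[R]_n) : measurableTypeR R * 'rV[R]_n :=
  (c * p.1, c *: p.2).
have mS : measurable_fun setT S.
  apply: measurable_fun_pair.
    exact: (measurableT_comp (mulrl_measurable _) measurable_fst).
  exact: (measurableT_comp (measurable_scale_rV _ _) measurable_snd).
have cn0 : 0 <= c ^+ n.+1 by rewrite exprn_ge0 ?ltW.
pose m := (lebesgue_measure \x @lebesgue_rV R n)%E.
pose m' := pushforward_measure (mscale (NngNum cn0) m) mS.
have m'E X : m' X = ((c ^+ n.+1)%:E * m (S @^-1` X))%E by [].
have lE B : lebesgue_rV B = m (@cons_rV R n @^-1` B) by [].
have -> : ((c ^+ n.+1)%:E * lebesgue_rV (( *:%R c) @^-1` A))%E =
    m' (@cons_rV R n @^-1` A).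
  rewrite m'E lE; congr (_ * m _)%E.
  apply/seteqP; split => p /=; suff -> : cons_rV (S p) = c *: cons_rV p by [];
    by apply/rowP => i; rewrite !mxE; case: unlift => [j|]; rewrite ?mxE.
rewrite lE; apply: product_measure_unique.
  move=> B C mB mC; rewrite m'E.
  have -> : S @^-1` (B `*` C) = (( *%R c) @^-1` B) `*` (( *:%R c) @^-1` C) by [].
  rewrite /m product_measure1E; last 2 first.
  - by rewrite -[X in measurable X]setTI; exact: mulrl_measurable.
  - by rewrite -[X in measurable X]setTI; exact: measurable_scale_rV.
  rewrite exprS EFinM muleACA -IH//; congr (_ * _)%E.
  exact/esym/lebesgue_measure_scale.
by rewrite -[X in measurable X]setTI; exact: measurable_cons_rV.
Qed.

Lemma measurable_ball_rV n (c : 'rV[R]_n) e : measurable (ball c e).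
Proof.
(* A ball of radius [e <= 0] is empty, whereas for [n = 0] the intersection of slabs used below is
   the whole space. *)
have [e0|e0] := ltP 0 e; last first.
  rewrite (_ : ball c e = set0)//; apply/seteqP; split => // x [].
  by rewrite ltNge e0.
have -> : ball c e = \bigcap_(i in [set: 'I_n])
    ((fun x : 'rV[R]_n => x ord0 i) @^-1` (ball (c ord0 i) e)).
  apply/seteqP; split => [x [_ h] i _|x h]; first exact: h.
  by split => // i j; rewrite (ord1 i); exact: h.
apply: fin_bigcap_measurable => // i _.
rewrite -[X in measurable X]setTI; apply: measurable_coor => //.
exact: measurable_ball.
Qed.

(** This links the topology to the product sigma-algebra: an open set is the countable union of the
    cubes with rational centre and radius [1 / (k + 1)] that it contains. *)
Lemma open_measurable_rV n (U : set 'rV[R]_n) : open U -> measurable U.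
Proof.
move=> oU.
pose B (p : 'rV[rat]_n * nat) : set 'rV[R]_n :=
  ball (map_mx ratr p.1 : 'rV[R]_n) p.2.+1%:R^-1.
have -> : U = \bigcup_p (if `[< B p `<=` U >] then B p else set0).
  apply/seteqP; split => [x Ux|x [p _]]; last by case: asboolP => // + Bx; exact.
  have /nbhs_ballP[e /= e0 xeU] : nbhs x U by exact: open_nbhs_nbhs.
  (* With radius below [e / 2], any such cube containing [x] lies in the ball of radius [e] about
     [x]. *)
  pose k := Num.truncn (2 / e).
  have ke : k.+1%:R^-1 < e / 2.
    rewrite invf_plt ?posrE// ?divr_gt0// invf_div; exact: truncnS_gt.
  have k0 : 0 < k.+1%:R^-1 :> R by rewrite invr_gt0.
  have /choice[q qP] : forall i, exists q : rat,
      ball (x ord0 i) k.+1%:R^-1 (ratr q).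
    move=> i; have [|q] := @rat_in_itvoo R (x ord0 i - k.+1%:R^-1) (x ord0 i + k.+1%:R^-1).
      by rewrite ltrD2l gtrN.
    rewrite in_itv/= => h; exists q; rewrite /ball/= ltr_distlC//.
  have Bx : B (\row_i q i, k) x.
    split => // i j; rewrite (ord1 i) !mxE; exact/ball_sym.
  exists (\row_i q i, k) => //; case: asboolP => //; case.
  move=> y By; apply: xeU.
  have -> : e = e / 2 + e / 2 by field.
  apply: (@ball_triangle _ _ (map_mx ratr (\row_i q i) : 'rV[R]_n)).
    by apply: le_ball (ball_sym Bx); exact: ltW.
  by apply: le_ball By; exact: ltW.
apply: countable_bigcupT_measurable => [|p]; first exact: countableP.
case: ifP => _; [exact: measurable_ball_rV|exact: measurable0].
Qed.

(** Balls are cubes of side [2 e]. Finiteness of the volume of Euclidean balls and positivity of the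
    spherical measure of open pieces both rest on this. *)
Lemma lebesgue_rV_ball n (c : 'rV[R]_n) e : 0 < e ->
  lebesgue_rV (ball c e) = ((e *+ 2) ^+ n)%:E.
Proof.
move=> e0; elim: n c => [|n IH] c.
  by rewrite /= diracE mem_set ?expr0//; split => // i [].
rewrite /= /pushforward.
have -> : @cons_rV R n @^-1` ball c e =
    ball (c ord0 ord0) e `*` ball (\row_j c ord0 (lift ord0 j)) e.
  apply/seteqP; split => [[a x] [_ h]|[a x] [/= h0 [_ h]]].
    split => /=.
      by have := h ord0 ord0; rewrite mxE unlift_none.
    split => // i j; have := h ord0 (lift ord0 j).
    by rewrite (ord1 i) !mxE liftK.
  split => // i j; rewrite (ord1 i) mxE; case: unliftP => [k|] ->//=.
  by have := h ord0 k; rewrite !mxE.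
rewrite product_measure1E; last 2 first.
- exact: measurable_ball.
- exact: measurable_ball_rV.
rewrite exprS EFinM; congr (_ * _)%E; last exact: IH.
exact/lebesgue_measure_ball/ltW.
Qed.

End lebesgue_scaling.

(** * Comparing a measure with a density up to factors tending to 1 *)

Lemma lee_mul_gt1 (R : realType) (x y : \bar R) : (0 <= x)%E -> (0 <= y)%E ->
  (forall c : R, 1 < c -> (x <= c%:E * y)%E) -> (x <= y)%E.
Proof.
case: y => [y| |]; [|by move=> _ _ _; exact: leey|by []].
case: x => [x| |]; [|by move=> _ _ /(_ 2 (ltr1n _ 2))|by []].
rewrite !lee_fin => x0 y0 h; rewrite leNgt; apply/negP => yx.
have [y00|yp] := eqVneq y 0.
  by have := h 2 (ltr1n _ 2); rewrite y00 mule0 lee_fin -y00 leNgt yx.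
have {}yp : 0 < y by rewrite lt_neqAle eq_sym yp.
(* This factor takes [y] to the midpoint of [x] and [y], which is below [x]. *)
have c1 : 1 < 1 + (x - y) / (2 * y).
  by rewrite ltrDl divr_gt0 ?subr_gt0// mulr_gt0.
have := h _ c1; rewrite -EFinM lee_fin.
have -> : (1 + (x - y) / (2 * y)) * y = (x + y) / 2.
  by field; rewrite gt_eqF.
lra.
Qed.

Section measure_density.
Context d (T : measurableType d) (R : realType).
Variables (mu nu : {measure set T -> \bar R}) (S : set T) (f : T -> R).
Hypothesis mS : measurable S.
Hypothesis mf : measurable_fun S f.
Hypothesis f_ge0 : forall x, S x -> 0 <= f x.

(** Summing the bounds over a disjoint refinement of the cover gives them on [S], and then [c] tends
    to 1. The cover may depend on [c]; having the bounds on all measurable subsets of [B k] is what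
    allows overlapping pieces to be made disjoint. *)
Lemma measure_eq_density :
  (forall c : R, 1 < c -> exists B : nat -> set T,
    [/\ forall k, measurable (B k), S = \bigcup_k B k &
      forall k A, measurable A -> A `<=` B k ->
        (nu A <= c%:E * \int[mu]_(x in A) (f x)%:E)%E /\
        (\int[mu]_(x in A) (f x)%:E <= c%:E * nu A)%E]) ->
  (nu S = \int[mu]_(x in S) (f x)%:E)%E.
Proof.
move=> H.
have f0 x : S x -> (0 <= (f x)%:E)%E by move=> Sx; rewrite lee_fin f_ge0.
suff key c : 1 < c ->
    (nu S <= c%:E * \int[mu]_(x in S) (f x)%:E)%E /\
    (\int[mu]_(x in S) (f x)%:E <= c%:E * nu S)%E.
  have I0 : (0 <= \int[mu]_(x in S) (f x)%:E)%E by exact: integral_ge0.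
  apply/eqP; rewrite eq_le; apply/andP; split;
    by apply: lee_mul_gt1 => // c /key[].
move=> c1; have [B [mB SB h]] := H c c1.
pose A := seqDU B.
have mA k : measurable (A k).
  by apply: measurableD => //; exact: bigsetU_measurable.
have AB k : A k `<=` B k by move=> x [].
have SA : S = \bigcup_k A k by rewrite SB seqDU_bigcup_eq.
have tA : trivIset setT A by exact: trivIset_seqDU.
have AS k x : A k x -> S x by rewrite SA => Ax; exists k.
have c0 : 0 <= c by lra.
have -> : (\int[mu]_(x in S) (f x)%:E =
    \sum_(k <oo) \int[mu]_(x in A k) (f x)%:E)%E.
  rewrite SA ge0_integral_bigcup//; rewrite -SA//.
  exact/measurable_EFinP.
have -> : (nu S = \sum_(k <oo) nu (A k))%E.
  rewrite SA measure_bigcup//.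
  by apply: eq_eseriesl => i; rewrite in_setT.
have I0 k : (0 <= \int[mu]_(x in A k) (f x)%:E)%E.
  by apply: integral_ge0 => x /AS; exact: f0.
rewrite -!nneseriesZl//.
by split; apply: lee_nneseries => k _ *; rewrite ?mule_ge0 ?lee_fin//;
  case: (h k (A k) (mA k) (AB k)).
Qed.

End measure_density.

(** * Directions, null sets and positivity of the spherical measure *)

Section polar.
Context {R : realType} {n : nat}.
Implicit Types (x u : 'rV[R]_n) (A K : set 'rV[R]_n).

Definition direction x := (enorm x)^-1 *: x.

Lemma enorm_ge0 x : 0 <= enorm x. Proof. exact: sqrtr_ge0. Qed.

Lemma enorm_eq0 x : (enorm x == 0) = (x == 0).
Proof.
apply/idP/idP => [|/eqP ->]; last first.
  by rewrite /enorm big1 ?sqrtr0// => i _; rewrite mxE expr0n.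
rewrite sqrtr_eq0 => h; apply/eqP/rowP => i; rewrite mxE.
have : \sum_(i < n) x ord0 i ^+ 2 == 0.
  by rewrite eq_le h/=; apply: sumr_ge0 => j _; exact: sqr_ge0.
rewrite psumr_eq0; last by move=> j _; exact: sqr_ge0.
by move=> /allP/(_ i (mem_index_enum _)); rewrite /= sqrf_eq0 => /eqP.
Qed.

Lemma enorm_gt0 x : (0 < enorm x) = (x != 0).
Proof. by rewrite lt_neqAle enorm_ge0 andbT eq_sym enorm_eq0. Qed.

Lemma coor_le_enorm x i : `|x ord0 i| <= enorm x.
Proof.
rewrite -sqrtr_sqr ler_sqrt; last by apply: sumr_ge0 => j _; exact: sqr_ge0.
rewrite (bigD1 i)//= lerDl; apply: sumr_ge0 => j _; exact: sqr_ge0.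
Qed.

Lemma enorm_continuous : continuous (@enorm R n).
Proof.
move=> x; apply: (@continuous_comp _ _ _
  (fun x : 'rV[R]_n => \sum_(i < n) x ord0 i ^+ 2) Num.sqrt).
  apply: continuous_big => [|i _ y]; first exact: add_continuous.
  apply: (@continuous_comp _ _ _ (fun x : 'rV[R]_n => x ord0 i)
    (fun z : R => z ^+ 2)); first exact: coord_continuous.
  exact: exprn_continuous.
exact: sqrt_continuous.
Qed.

Lemma direction_continuous x : x != 0 -> {for x, continuous direction}.
Proof.
move=> x0; apply: continuousZ; last exact: cvg_id.
by apply: continuousV; [rewrite enorm_eq0|exact: enorm_continuous].
Qed.

Lemma measurable_direction : measurable_fun setT direction.
Proof.
apply/measurable_fun_rVP => i; under eq_fun do rewrite mxE.
apply: measurable_funM; last exact: measurable_coor.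
exact: (measurableT_comp measurable_inv measurable_enorm).
Qed.

Lemma esphere_direction x : x != 0 -> esphere (direction x).
Proof.
move=> x0; rewrite /esphere /= /direction enormZ ger0_norm ?invr_ge0 ?enorm_ge0//.
by rewrite mulVf// enorm_eq0.
Qed.

Lemma esphere_neq0 u : esphere u -> u != 0.
Proof. by move=> Su; rewrite -enorm_eq0 Su oner_eq0. Qed.

Lemma enorm_direction x : enorm x *: direction x = x.
Proof.
have [->|x0] := eqVneq x 0; first by rewrite /direction !scaler0.
by rewrite scalerA mulfV ?scale1r// enorm_eq0.
Qed.

Lemma directionZ t u : 0 < t -> esphere u -> direction (t *: u) = u.
Proof.
move=> t0 Su; rewrite /direction enormZ Su mulr1 gtr0_norm// scalerA.
by rewrite mulVf ?scale1r// gt_eqF.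
Qed.

Lemma measurable_set1_rV x : measurable [set x].
Proof.
rewrite (_ : [set x] = \bigcap_(k in [set: nat]) ball x k.+1%:R^-1).
  by apply: bigcap_measurableType => k _; exact: measurable_ball_rV.
apply/seteqP; split => [_ -> k _|y h].
  by apply: ballxx; rewrite invr_gt0.
apply/esym/rowP => i; apply/eqP; rewrite -subr_eq0 -normr_le0.
apply/ler_addgt0Pr => e e0; rewrite add0r.
have [_ /(_ ord0 i)] := h (Num.truncn e^-1) I.
rewrite /ball /= => /ltW /le_trans; apply; apply: ltW.
by rewrite invf_plt ?posrE// truncnS_gt.
Qed.

(** In dimension 0 the sphere is empty and the origin has mass 1. *)
Hypothesis n_gt0 : (0 < n)%N.

Lemma exists_esphere : exists u, esphere u.
Proof.
exists (direction (const_mx 1)); apply: esphere_direction.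
apply/eqP => /rowP /(_ (Ordinal n_gt0)) /eqP; rewrite !mxE.
by rewrite oner_eq0.
Qed.

Lemma lebesgue_rV_eball_lty r : (lebesgue_rV (@eball R n r) < +oo)%E.
Proof.
(* The radius [|r| + 1] is positive and exceeds [r] whatever the sign of [r], as the open cube
   requires. *)
apply: (@le_lt_trans _ _ (lebesgue_rV (ball (0 : 'rV[R]_n) (`|r| + 1)))).
  apply: le_measure; rewrite ?inE.
  - exact: measurable_eball.
  - exact: measurable_ball_rV.
  - move=> x /= xr; split; first by rewrite ltr_wpDl.
    move=> i j; rewrite (ord1 i) mxE /ball/= sub0r normrN.
    rewrite (le_lt_trans (coor_le_enorm x j))// (le_lt_trans xr)//.
    by rewrite (le_lt_trans (ler_norm r))// ltrDl.
by rewrite lebesgue_rV_ball ?ltry// ltr_wpDl.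
Qed.

(** The origin is fixed by the dilation of ratio 2, so its mass [v] satisfies [v = 2 ^+ n * v]; it
    is finite because the unit ball has finite volume, hence zero. *)
Lemma lebesgue_rV0 : lebesgue_rV [set (0 : 'rV[R]_n)] = 0%E.
Proof.
have := @lebesgue_rV_scale R n 2 [set 0] ltac:(lra) (measurable_set1_rV 0).
have -> : ( *:%R 2) @^-1` [set (0 : 'rV[R]_n)] = [set 0].
  apply/seteqP; split => x /=; last by move=> ->; rewrite scaler0.
  by move=> /eqP; rewrite scaler_eq0 pnatr_eq0/= => /eqP.
have : lebesgue_rV [set (0 : 'rV[R]_n)] \is a fin_num.
  rewrite ge0_fin_numE//; apply: le_lt_trans (lebesgue_rV_eball_lty 1).
  apply: le_measure; rewrite ?inE.
  - exact: measurable_set1_rV.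
  - exact: measurable_eball.
  - by move=> _ ->; rewrite /eball /= (eqP (_ : enorm 0 == 0)) ?enorm_eq0.
move=> /fineK <-; rewrite -EFinM => -[] /eqP.
move: (fine _) => v; rewrite -subr_eq0 -{1}[v]mul1r -mulrBl mulf_eq0.
rewrite subr_eq0 => /orP[/eqP e|/eqP -> //].
have : (1 : R) < 2 ^+ n by rewrite exprn_egt1 ?ltr1n// -lt0n.
by rewrite -e ltxx.
Qed.

Lemma lebesgue_rV_setD0 A : measurable A ->
  lebesgue_rV (A `\` [set 0]) = lebesgue_rV A.
Proof.
move=> mA; have -> : lebesgue_rV A =
    (lebesgue_rV (A `\` [set 0%R]) + lebesgue_rV (A `&` [set 0%R]))%E.
  by apply: measureDI => //; exact: measurable_set1_rV.
rewrite (_ : lebesgue_rV (A `&` [set 0]) = 0%E) ?adde0//.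
apply/eqP; rewrite -measure_le0 -[leRHS]lebesgue_rV0.
apply: le_measure; rewrite ?inE//; last exact: measurable_set1_rV.
by apply: measurableI => //; exact: measurable_set1_rV.
Qed.

Lemma spherical_measure_esphere :
  spherical_measure (@esphere R n) = (n%:R%:E * lebesgue_rV (@eball R n 1))%E.
Proof.
rewrite /spherical_measure -[in RHS]lebesgue_rV_setD0; last exact: measurable_eball.
rewrite coneE; congr (_ * lebesgue_rV _)%E.
apply/seteqP; split => x /=; first by move=> [[? /eqP]]; rewrite enorm_eq0 => /eqP.
move=> [? /eqP x0]; split; last exact: esphere_direction.
by split => //; apply/eqP; rewrite enorm_eq0.
Qed.

Lemma lebesgue_rV_eball r : 0 < r ->
  lebesgue_rV (@eball R n r) = ((r ^+ n)%:E * lebesgue_rV (@eball R n 1))%E.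
Proof.
move=> r0; rewrite (@lebesgue_rV_scale R n r)//; last exact: measurable_eball.
congr (_ * lebesgue_rV _)%E; apply/seteqP; split => x;
  by rewrite /eball /= enormZ gtr0_norm// -ler_pdivlMl// mulVf ?gt_eqF.
Qed.

(** The point [u / 2] is interior to the cone over these directions: near it the direction stays in
    [V] and the norm stays strictly between 0 and 1. So the cone contains a small cube. *)
Lemma spherical_measure_open_gt0 (V : set 'rV[R]_n) u : open V -> V u ->
  esphere u -> (0 < spherical_measure (esphere `&` V))%E.
Proof.
move=> oV Vu Su; rewrite /spherical_measure mule_gt0 ?lte_fin ?ltr0n//.
pose v := 2^-1 *: u.
have v0 : v != 0 by rewrite scaler_eq0 invr_eq0 pnatr_eq0 esphere_neq0.
have dv : direction v = u by rewrite directionZ.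
have ev : enorm v < 1 by rewrite enormZ Su mulr1 gtr0_norm; lra.
have h1 : \forall x \near v, V (direction x).
  have dV : nbhs (direction v) V by rewrite dv; exact: open_nbhs_nbhs.
  exact: (direction_continuous _ v0 V dV).
have h2 : \forall x \near v, enorm x < 1.
  exact: (cvgr_lt _ (enorm_continuous v)).
have h3 : \forall x \near v, 0 < enorm x.
  by apply: (cvgr_gt _ (enorm_continuous v)); rewrite enorm_gt0.
have /nbhs_ballP[e /= e0 he] : \forall x \near v, 
    [/\ V (direction x), enorm x < 1 & 0 < enorm x].
  by near=> x; split; near: x.
apply: (@lt_le_trans _ _ (lebesgue_rV (ball v e))).
  by rewrite lebesgue_rV_ball// lte_fin exprn_gt0// mulrn_wgt0.
apply: le_measure; rewrite ?inE.
- exact: measurable_ball_rV.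
- apply: measurable_cone; apply: measurableI; first exact: measurable_esphere.
  exact: open_measurable_rV.
- move=> x /he [Vx x1 x0].
  exists (enorm x), (direction x); rewrite x0 (ltW x1) enorm_direction.
  have ? : esphere (direction x) by apply: esphere_direction; rewrite -enorm_gt0.
  by split.
Unshelve. all: by end_near.
Qed.

End polar.

(** * Volume of a star body in polar coordinates *)

Section star_body_volume.
Context {R : realType} {n : nat}.
Variable K : set 'rV[R]_n.
Hypothesis n_gt0 : (0 < n)%N.
Hypothesis sK : star_body K.

Lemma radial_gt0 u : esphere u -> 0 < radial K u.
Proof. by case: sK => _ _ h _; exact: h. Qed.

Lemma star_bodyZ u (t : R) : esphere u -> 0 <= t -> K (t *: u) <-> t <= radial K u.
Proof.
case: sK => star mx _ _ Su t0; have [rK rub] := mx u Su.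
split=> [|tr]; first exact: rub.
have r0 := radial_gt0 _ Su.
have -> : t *: u = (t / radial K u) *: (radial K u *: u).
  by rewrite scalerA divfK// gt_eqF.
by apply: star => //; rewrite divr_ge0 ?(ltW r0)//= ler_pdivrMr// mul1r.
Qed.

Lemma star_body_direction x : x != 0 ->
  K x <-> enorm x <= radial K (direction x).
Proof.
move=> x0; rewrite -star_bodyZ ?enorm_direction//; last exact: enorm_ge0.
exact: esphere_direction.
Qed.

Lemma star_body0 : K 0.
Proof.
have [u Su] := @exists_esphere R n n_gt0.
by rewrite -(scale0r u); apply/star_bodyZ => //; rewrite ltW// radial_gt0.
Qed.

(** Continuity holds within the sphere, so the preimage of an open interval is the trace on
    [esphere] of an open set of R^n, which is measurable. *)
Lemma measurable_radial : measurable_fun esphere (radial K).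
Proof.
case: sK => _ _ _ /continuousP cr mS.
apply: (measurability _ (RGenOpens.measurableE R)) => //.
move=> _ [_ [a [b ->] <-]].
have /open_subspaceP[V oV VE] : open (from_subspace esphere (radial K) @^-1` `]a, b[).
  exact/cr/interval_open.
rewrite setIC -VE; apply: measurableI => //.
exact: open_measurable_rV.
Qed.

Let mD : measurable (~` [set (0 : 'rV[R]_n)]).
Proof. by apply: measurableC; exact: measurable_set1_rV. Qed.

Lemma measurable_star_bodyD0 : measurable (K `\` [set 0]).
Proof.
have -> : K `\` [set 0] =
    ~` [set 0] `&` [set x | enorm x <= radial K (direction x)].
  apply/seteqP; split => x /=.
    by move=> [Kx x0]; split => //; apply/star_body_direction => //; exact/eqP.
  by move=> [x0 Kx]; split => //; apply/star_body_direction => //; exact/eqP.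
apply: measurable_fun_le => //.
  by apply: measurable_funTS; exact: measurable_enorm.
apply: (@measurable_comp _ _ _ _ _ _ esphere (radial K) _ direction).
- exact: measurable_esphere.
- by move=> _ [x /eqP x0 <-]; exact: esphere_direction.
- exact: measurable_radial.
- by apply: measurable_funTS; exact: measurable_direction.
Qed.

Lemma measurable_star_body : measurable K.
Proof.
rewrite (_ : K = (K `\` [set 0]) `|` [set 0]).
  apply: measurableU; first exact: measurable_star_bodyD0.
  exact: measurable_set1_rV.
apply/seteqP; split => x; last by move=> [[]//|->]; exact: star_body0.
by move=> Kx; have [->|/eqP x0] := eqVneq x 0; [right|left].
Qed.

(** The part of [K] above the directions in [A], without the origin, which has no direction. *)
Let KD (A : set 'rV[R]_n) := (direction @^-1` A) `&` (K `\` [set 0]).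

Let mKD A : measurable A -> measurable (KD A).
Proof.
move=> mA; apply: measurableI; last exact: measurable_star_bodyD0.
by rewrite -[X in measurable X]setTI; exact: measurable_direction.
Qed.

(** The dilate by [a] of the cone over [A] is contained in [KD A]. *)
Let cone_le (a : R) A : 0 < a -> measurable A -> A `<=` esphere ->
  (forall u, A u -> a <= radial K u) ->
  ((a ^+ n)%:E * lebesgue_rV (cone A) <= lebesgue_rV (KD A))%E.
Proof.
move=> a0 mA AS ha; rewrite [leRHS](@lebesgue_rV_scale R n a)//; last exact: mKD.
rewrite lee_pmul2l// ?lte_fin ?exprn_gt0//; apply: le_measure; rewrite ?inE.
- exact: measurable_cone.
- rewrite -[X in measurable X]setTI; apply: measurable_scale_rV => //.
  exact: mKD.
- move=> _ [t [u [/andP[t0 t1] Su Au ->]]]; rewrite /KD /= scalerA.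
  have at0 : 0 < a * t by rewrite mulr_gt0.
  split; first by rewrite directionZ.
  split; last by apply/eqP; rewrite scaler_eq0 gt_eqF//= esphere_neq0.
  apply/star_bodyZ; rewrite ?(ltW at0)//.
  by rewrite (le_trans _ (ha u Au))// ger_pMr.
Qed.

(** Conversely, shrinking [KD A] by the factor [b] brings it inside the cone over [A]. *)
Let le_cone (b : R) A : 0 < b -> measurable A -> A `<=` esphere ->
  (forall u, A u -> radial K u <= b) ->
  (lebesgue_rV (KD A) <= (b ^+ n)%:E * lebesgue_rV (cone A))%E.
Proof.
move=> b0 mA AS hb; rewrite [leLHS](@lebesgue_rV_scale R n b)//; last exact: mKD.
rewrite lee_pmul2l// ?lte_fin ?exprn_gt0//; apply: le_measure; rewrite ?inE.
- rewrite -[X in measurable X]setTI; apply: measurable_scale_rV => //.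
  exact: mKD.
- exact: measurable_cone.
- move=> x [/= Ax [Kx /eqP x0]].
  have {}x0 : x != 0 by apply: contra x0 => /eqP ->; rewrite scaler0.
  have dE : direction (b *: x) = direction x.
    rewrite -[in LHS](enorm_direction x) scalerA directionZ//.
      by rewrite mulr_gt0// enorm_gt0.
    exact: esphere_direction.
  rewrite dE in Ax.
  exists (enorm x), (direction x); split.
  - rewrite enorm_gt0 x0/= -(ler_pM2l b0) mulr1 (le_trans _ (hb _ Ax))//.
    rewrite -[b in leLHS](gtr0_norm b0) -enormZ -dE.
    by apply/star_body_direction => //; rewrite scaler_eq0 gt_eqF.
  - exact: AS.
  - exact: Ax.
  - by rewrite enorm_direction.
Qed.

Lemma star_body_polar :
  (n%:R%:E * lebesgue_rV K =
   \int[spherical_measure]_(u in esphere) (radial K u ^+ n)%:E)%E.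
Proof.
have n0 : 0 <= n%:R :> R by [].
(* Pushing the volume on [K] forward along [direction] gives a measure on directions, to be compared
   with the density [radial K u ^+ n]; its value on the sphere is [n |K|] because the origin is
   null. *)
pose nu := mscale (NngNum n0) (pushforward_measure
  (mrestr (@lebesgue_rV R n) measurable_star_bodyD0) measurable_direction).
have nuE A : nu A = (n%:R%:E * lebesgue_rV (KD A))%E by [].
have -> : (n%:R%:E * lebesgue_rV K = nu esphere)%E.
  rewrite nuE -(lebesgue_rV_setD0 n_gt0 _ measurable_star_body).
  congr (_ * lebesgue_rV _)%E.
  apply/seteqP; split => [x [Kx x0]|x []//]; split => //.
  by apply: esphere_direction; exact/eqP.
have mS := @measurable_esphere R n.
have mrn : measurable_fun esphere (fun u => radial K u ^+ n).
  by apply: measurable_funX; exact: measurable_radial.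
have rn0 u : esphere u -> 0 <= radial K u ^+ n.
  by move=> Su; rewrite exprn_ge0// ltW// radial_gt0.
apply: measure_eq_density => // C C1.
(* Radii in ratio [c] correspond to volumes in ratio [C]. *)
pose c := C `^ n%:R^-1.
have cn : c ^+ n = C.
  rewrite -powR_mulrn ?powR_ge0// -powRrM mulVf ?pnatr_eq0 -?lt0n//.
  by rewrite powRr1//; lra.
have c0 : 0 < c by apply: powR_gt0; lra.
have c1 : 1 < c.
  by rewrite ltNge; apply/negP => /(exprn_ile1 n (ltW c0)); rewrite cn leNgt C1.
(* The pieces are indexed by rationals [q > 0] through their codes: on each, the radial function
   lies between [q] and [c * q]. Every other index gives the empty set. *)
pose B k : set 'rV[R]_n := if unpickle k is Some q then
  esphere `&` [set u | 0 < ratr q :> R /\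
                       ratr q <= radial K u <= c * ratr q] else set0.
exists B; split.
- move=> k; rewrite /B; case: unpickle => [q|]; last exact: measurable0.
  have [q0|q0] := ltP 0 (ratr q : R); last first.
    rewrite (_ : _ `&` _ = set0); first exact: measurable0.
    by apply/seteqP; split => // u [_ [+ _]].
  have -> : esphere `&` [set u | true /\ ratr q <= radial K u <= c * ratr q] =
      esphere `&` radial K @^-1` `[ratr q, c * ratr q].
    apply/seteqP; split => u /=; rewrite in_itv/= => -[Su].
      by move=> [].
    by split.
  exact: measurable_radial.
- apply/seteqP; split => [u Su|u [k _]]; last first.
    by rewrite /B; case: unpickle => [q|]// [].
  have r0 := radial_gt0 _ Su.
  (* A rational just below the radial function at [u] puts [u] in its piece; the interval is
     nonempty since [c > 1]. *)
  have [|q] := @rat_in_itvoo R (radial K u / c) (radial K u).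
    by rewrite ltr_pdivrMr// ltr_pMr.
  rewrite in_itv/= ltr_pdivrMr// => /andP[q1 q2].
  exists (pickle q); [exact: I|rewrite /B pickleK; split; first exact: Su].
  have q0 : 0 < ratr q :> R.
    by move: (lt_trans r0 q1); rewrite pmulr_lgt0.
  by split => //; rewrite (ltW q2)/= mulrC ltW.
- move=> k A mA; rewrite /B; case: unpickle => [q AB|A0]; last first.
    have -> : A = set0 by apply/seteqP; split => // u /A0.
    by rewrite integral_set0 measure0 mule0.
  have [A0|/set0P[u0 Au0]] := eqVneq A set0.
    by rewrite A0 integral_set0 measure0 mule0.
  have q0 : 0 < ratr q :> R by have [_ []] := AB _ Au0.
  have AS : A `<=` esphere by move=> u /AB[].
  have cq0 : 0 < c * ratr q by rewrite mulr_gt0.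
  have mrnA : measurable_fun A (fun u => (radial K u ^+ n)%:E).
    by apply/measurable_EFinP; exact: measurable_funS mrn.
  have lo : (((ratr q) ^+ n)%:E * spherical_measure A <=
      \int[spherical_measure]_(u in A) (radial K u ^+ n)%:E)%E.
    rewrite -[leLHS](integral_cst _ mA) ge0_le_integral//.
    - by move=> u _; rewrite lee_fin exprn_ge0// ltW.
    - move=> u /AB[Su [_ /andP[h1 h2]]].
      by rewrite lee_fin lerXn2r// nnegrE ltW// radial_gt0.
  have hi : (\int[spherical_measure]_(u in A) (radial K u ^+ n)%:E <=
      ((c * ratr q) ^+ n)%:E * spherical_measure A)%E.
    rewrite -[leRHS](integral_cst _ mA) ge0_le_integral//.
    - by move=> u /AS/rn0; rewrite lee_fin.
    - move=> u /AB[Su [_ /andP[h1 h2]]].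
      by rewrite lee_fin lerXn2r// nnegrE ltW// radial_gt0.
  have n0' : (0 <= n%:R%:E :> \bar R)%E by rewrite lee_fin.
  have C0 : (0 <= C%:E)%E by rewrite lee_fin; lra.
  (* Both quantities lie between [q ^+ n] and [C * q ^+ n] times the spherical measure of [A], so
     each is at most [C] times the other. *)
  suff : (n%:R%:E * lebesgue_rV (KD A) <=
        C%:E * \int[spherical_measure]_(u in A) (radial K u ^+ n)%:E)%E /\
      (\int[spherical_measure]_(u in A) (radial K u ^+ n)%:E <=
        C%:E * (n%:R%:E * lebesgue_rV (KD A)))%E by [].
  split.
    apply: (@le_trans _ _ (C%:E * ((ratr q ^+ n)%:E * spherical_measure A))%E).
      rewrite muleA -EFinM -cn -exprMn /spherical_measure muleCA.
      apply: lee_wpmul2l => //; apply: le_cone => //.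
      by move=> u /AB[_ [_ /andP[]]].
    exact: lee_wpmul2l.
  apply: (le_trans hi); rewrite exprMn cn EFinM -muleA.
  apply: lee_wpmul2l => //; rewrite /spherical_measure muleCA.
  apply: lee_wpmul2l => //; apply: cone_le => //.
  by move=> u /AB[_ [_ /andP[]]].
Qed.

End star_body_volume.

(** * Dual surface area and comparison with the ball *)

Section dual_area.
Context {R : realType} {n : nat}.
Implicit Types (K : set 'rV[R]_n) (phi : R -> R).
Hypothesis n_gt0 : (0 < n)%N.

Lemma radial_eball (r : R) (u : 'rV[R]_n) : 0 < r -> esphere u ->
  radial (eball r) u = r.
Proof.
move=> r0 Su.
have E l : radial_set (eball r) u l <-> `|l| <= r.
  by rewrite /radial_set /eball /= enormZ Su mulr1.
have ub : ubound (radial_set (eball r) u) r.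
  by move=> l /E; exact: le_trans (ler_norm l).
apply/eqP; rewrite eq_le; apply/andP; split.
  by apply: ge_sup => //; exists 0; apply/E; rewrite normr0 ltW.
by apply: ub_le_sup; [exists r|apply/E; rewrite gtr0_norm].
Qed.

Lemma dual_surface_areaE phi K : dual_surface_area phi K =
  (\int[spherical_measure]_(u in esphere)
     (phi (radial K u) * radial K u ^+ n)%:E)%E.
Proof.
rewrite /dual_surface_area /dual_mixed_volume muleA -EFinM mulfV; last first.
  by rewrite pnatr_eq0 -lt0n.
rewrite mul1e; apply: eq_integral => u; rewrite inE => Su.
by rewrite (radial_eball 1 u ltr01 Su) divr1.
Qed.

(** This turns [phi] of the radial function into [F (1 / w)] with [w = radial K u ^+ n], the form in
    which Jensen's inequality applies. *)
Lemma orlicz_FV phi (x : R) : 0 < x -> orlicz_F n phi (x ^+ n)^-1 = phi x.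
Proof.
move=> x0; rewrite /orlicz_F; congr phi.
rewrite -powR_mulrn ?(ltW x0)// -powRN -powRrM mulrNN mulfV.
  by rewrite powRr1// ltW.
by rewrite pnatr_eq0 -lt0n.
Qed.

Lemma orlicz_F_gt0 phi : positive_pos phi ->
  {in posreals, forall t, 0 < orlicz_F n phi t}.
Proof.
move=> phi0 t; rewrite in_posreals => t0.
by apply: phi0; rewrite in_posreals powR_gt0.
Qed.

(** This merges the constant alternative of [Phi] into the convex one. *)
Lemma constant_pos_convex (F : R -> R) : constant_pos F -> convex_pos F.
Proof.
move=> [c Fc] t x y; rewrite !in_posreals => x0 y0.
rewrite !Fc ?in_posreals//; last exact: convR_gt0.
by rewrite convmm.
Qed.

Lemma constant_pos_concave (F : R -> R) : constant_pos F -> concave_pos F.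
Proof.
move=> [c Fc]; apply: constant_pos_convex; exists (- c) => t t0.
by rewrite /= Fc.
Qed.

Variables (K : set 'rV[R]_n) (r : R).
Hypothesis sK : star_body K.
Hypothesis r_gt0 : 0 < r.
Hypothesis volK : lebesgue_rV (@eball R n r) = lebesgue_rV K.

Lemma star_body_radial_cst : {in esphere, forall u, radial K u = r} ->
  K = eball r.
Proof.
move=> rK; apply/seteqP.
suff E x : K x <-> eball r x by split => x /E.
have [->|x0] := eqVneq x 0.
  split=> _; last exact: star_body0.
  by rewrite /eball /= (eqP (_ : enorm 0 == 0)) ?enorm_eq0// ltW.
rewrite star_body_direction// rK// inE; exact: esphere_direction.
Qed.

(* [radial K ^+ n] differs from [r ^+ n] on a relatively open subset of the
   sphere, and such a set has positive measure unless it is empty. *)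
Lemma star_body_radial_ae :
  spherical_measure (esphere `&` [set u | radial K u ^+ n != r ^+ n]) = 0%E ->
  K = eball r.
Proof.
move=> h; apply: star_body_radial_cst => u; rewrite inE => Su.
apply/eqP; apply/negPn/negP => rKu.
case: sK => _ _ _ /continuousP cr.
have oN : open (~` [set r]).
  exact/closed_openC/accessible_closed_set1/hausdorff_accessible/Rhausdorff.
have /open_subspaceP[V oV VE] :
  open (from_subspace esphere (radial K) @^-1` (~` [set r])) by exact: cr.
have Vu : V u.
  have [] : (V `&` esphere) u by rewrite VE; split => //=; exact/eqP.
  by [].
have := spherical_measure_open_gt0 n_gt0 V u oV Vu Su.
rewrite setIC VE (_ : _ `&` _ = esphere `&` [set u | radial K u ^+ n != r ^+ n]).
  by rewrite h ltxx.
rewrite setIC; apply/seteqP; split => v /= [Sv];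
  have r0 := radial_gt0 _ sK _ Sv; rewrite eqrXn2// ?ltW//.
- by move=> /eqP.
- by move=> /eqP.
Qed.

(** Positivity is read off the whole sphere: its spherical measure is positive and equals [n] times
    this volume. *)
Let ball_fin : exists2 k : R, 0 < k & lebesgue_rV (@eball R n 1) = k%:E.
Proof.
have /fineK E : lebesgue_rV (@eball R n 1) \is a fin_num.
  by rewrite ge0_fin_numE// lebesgue_rV_eball_lty.
exists (fine (lebesgue_rV (@eball R n 1))); last by rewrite E.
have [u Su] := @exists_esphere R n n_gt0.
have := spherical_measure_open_gt0 n_gt0 setT u openT I Su.
rewrite setIT spherical_measure_esphere// -E -EFinM lte_fin.
by rewrite pmulr_rgt0 ?ltr0n.
Qed.

Let W : R := n%:R * fine (lebesgue_rV K).

(** These are the hypotheses [wW] and [muD] of the Jensen section with [s = 1 / r ^+ n]. Equality of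
    volumes enters here, as [|K|] is [r ^+ n] times the volume of the unit ball. *)
Let sphereW :
  (\int[spherical_measure]_(u in esphere) (radial K u ^+ n)%:E = W%:E)%E /\
  spherical_measure (@esphere R n) = ((r ^+ n)^-1 * W)%:E.
Proof.
have [k k0 kE] := ball_fin.
have KE : lebesgue_rV K = (r ^+ n * k)%:E.
  by rewrite -volK lebesgue_rV_eball// kE.
rewrite -star_body_polar// spherical_measure_esphere// kE /W KE.
split=> //; rewrite -EFinM; congr (_%:E); rewrite /=; field.
by rewrite expf_neq0// gt_eqF.
Qed.

Let rn_gt0 u : esphere u -> 0 < radial K u ^+ n.
Proof. by move=> Su; rewrite exprn_gt0// radial_gt0. Qed.

Let areaK phi : dual_surface_area phi K =
  (\int[spherical_measure]_(u in esphere)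
    (orlicz_F n phi (radial K u ^+ n)^-1 * radial K u ^+ n)%:E)%E.
Proof.
rewrite dual_surface_areaE; apply: eq_integral => u; rewrite inE => Su.
by rewrite orlicz_FV// radial_gt0.
Qed.

Let areaB phi : dual_surface_area phi (@eball R n r) =
  (orlicz_F n phi (r ^+ n)^-1 * W)%:E.
Proof.
rewrite dual_surface_areaE orlicz_FV//.
under eq_integral => u /[!inE] Su do rewrite (radial_eball r u r_gt0 Su).
rewrite -[LHS]/(\int[spherical_measure]_(u in @esphere R n)
  (cst (phi r * r ^+ n)%:E u))%E.
rewrite integral_cst; last exact: measurable_esphere.
rewrite -[X in (_ * X)%E]/(spherical_measure (@esphere R n)) sphereW.2.
rewrite -EFinM; congr (_%:E); field.
by rewrite expf_neq0// gt_eqF.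
Qed.

Let mrn : measurable_fun esphere (fun u => radial K u ^+ n).
Proof. by apply: measurable_funX; exact: measurable_radial. Qed.

(** The unit ball has finite positive volume, so equal volumes force equal powers of the radii. *)
Lemma origin_ball_vol : origin_ball K -> K = eball r.
Proof.
move=> [r' r'0 KE]; move: volK; rewrite KE.
rewrite (lebesgue_rV_eball r r_gt0) (lebesgue_rV_eball r' r'0).
have [k k0 ->] := ball_fin; rewrite -!EFinM => -[].
move=> /(mulIf (lt0r_neq0 k0)) /eqP.
by rewrite eqrXn2 ?(ltW r_gt0) ?(ltW r'0)// => /eqP ->.
Qed.

Lemma dual_surface_area_convex phi : Phi n phi ->
  (dual_surface_area phi (@eball R n r) <= dual_surface_area phi K)%E /\
  (strictly_convex_pos (orlicz_F n phi) ->
    (dual_surface_area phi K = dual_surface_area phi (@eball R n r) <->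
     origin_ball K)).
Proof.
move=> [phi0 phiF].
have cF : convex_pos (orlicz_F n phi).
  by case: phiF => // /constant_pos_convex.
have s0 : 0 < (r ^+ n)^-1 by rewrite invr_gt0 exprn_gt0.
have [le eq] := jensen_convex _ _ _ _ _ measurable_esphere _ _ _ mrn rn_gt0 s0
  sphereW.1 sphereW.2 _ cF (orlicz_F_gt0 _ phi0).
rewrite areaK areaB; split=> // sF; split=> [E|/origin_ball_vol KE].
  exists r => //; apply: star_body_radial_ae.
  (* The null set from the equality case is where [w] differs from [s^-1], and [s^-1] is
     [r ^+ n]. *)
  by have := eq sF E; rewrite invrK.
by rewrite -areaK -areaB {1}KE.
Qed.

Lemma dual_surface_area_concave phi : Psi n phi ->
  (dual_surface_area phi K <= dual_surface_area phi (@eball R n r))%E /\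
  (strictly_concave_pos (orlicz_F n phi) ->
    (dual_surface_area phi K = dual_surface_area phi (@eball R n r) <->
     origin_ball K)).
Proof.
move=> [phi0 phiF].
have cF : concave_pos (orlicz_F n phi).
  by case: phiF => [/constant_pos_concave//|[]].
have s0 : 0 < (r ^+ n)^-1 by rewrite invr_gt0 exprn_gt0.
have [le eq] := jensen_concave _ _ _ _ _ measurable_esphere _ _ _ mrn rn_gt0 s0
  sphereW.1 sphereW.2 _ cF (orlicz_F_gt0 _ phi0).
rewrite areaK areaB; split=> // sF; split=> [E|/origin_ball_vol KE].
  exists r => //; apply: star_body_radial_ae.
  by have := eq sF E; rewrite invrK.
by rewrite -areaK -areaB {1}KE.
Qed.

End dual_area.

Theorem theorem4p2 (R : realType) (n : nat) (n_gt0 : (0 < n)%N)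
    (K BK : set 'rV[R]_n) :
  star_body K -> origin_ball BK -> lebesgue_rV BK = lebesgue_rV K ->
  (forall phi : R -> R, Phi n phi ->
     (dual_surface_area phi BK <= dual_surface_area phi K)%E /\
     (strictly_convex_pos (orlicz_F n phi) ->
        (dual_surface_area phi K = dual_surface_area phi BK <->
         origin_ball K))) /\
  (forall phi : R -> R, Psi n phi ->
     (dual_surface_area phi K <= dual_surface_area phi BK)%E /\
     (strictly_concave_pos (orlicz_F n phi) ->
        (dual_surface_area phi K = dual_surface_area phi BK <->
         origin_ball K))).
Proof.
move=> sK [r r0 ->] volK; split=> phi.
  exact: dual_surface_area_convex.
exact: dual_surface_area_concave.
Qed.
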